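(* Let $G$ be a finite DS group of odd order whose Sylow $3$-subgroups are not isomorphic to $C_3\times C_3$. Then $G$ has a presentation $$G=\langle a,b\mid a^m=1=b^n,\ b^{-1}ab=a^r\rangle,$$ where $r^n\equiv 1\pmod m$, $m$ is odd, $0\leq r\leq m$, and $m$ and $n(r-1)$ are coprime.
   Context: For a finite group $G$ and a subset $S\subseteq G\setminus\{1\}$ with $S=S^{-1}$, the Cayley graph $Cay(G,S)$ has vertex set $G$, with $a,b$ adjacent iff $ab^{-1}\in S$. The spectrum of a graph is the multiset of eigenvalues of its adjacency matrix. A finite group $G$ is DS if every Cayley graph $\Gamma$ on $G$ is isomorphic to every (finite simple) graph $\Gamma'$ with the same spectrum as $\Gamma$. $C_n$ is the cyclic group of order $n$. *)

(* Defs.v *)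
From mathcomp Require Import all_boot all_order all_algebra all_fingroup.
From mathcomp Require Import all_solvable all_field.

Set Implicit Arguments.
Unset Strict Implicit.
Unset Printing Implicit Defensive.

Import GRing.Theory.

Local Open Scope ring_scope.

Definition simple_graph (T : finType) (e : rel T) : Prop :=
  symmetric e /\ irreflexive e.

Definition graph_isom (T U : finType) (e : rel T) (f : rel U) : Prop :=
  exists2 h : T -> U, bijective h & forall x y, f (h x) (h y) = e x y.

Definition adjacency_mx (T : finType) (e : rel T) : 'M[algC]_#|T| :=
  \matrix_(i, j) (e (enum_val i) (enum_val j))%:R.

(* The eigenvalues listed with multiplicity, in an unspecified order: equality
   of spectra as multisets is perm_eq. *)
Definition spectrum (T : finType) (e : rel T) : seq algC :=
  sval (closed_field_poly_normal (char_poly (adjacency_mx e))).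

Definition cospectral (T U : finType) (e : rel T) (f : rel U) : Prop :=
  perm_eq (spectrum e) (spectrum f).

Definition Cay (gT : finGroupType) (S : {set gT}) : rel gT :=
  [rel a b | (a * b^-1)%g \in S].

Definition DS_group (gT : finGroupType) : Prop :=
  forall S : {set gT}, 1%g \notin S -> (S^-1)%g = S ->
  forall (T : finType) (e : rel T), simple_graph e ->
    cospectral (Cay S) e -> graph_isom (Cay S) e.

Lemma spectrumE (T : finType) (e : rel T) :
  char_poly (adjacency_mx e) = \prod_(z <- spectrum e) ('X - z%:P).
Proof.
rewrite /spectrum; case: closed_field_poly_normal => r /= {1}->.
by rewrite (monicP (char_poly_monic _)) scale1r.
Qed.

Lemma simple_graph_Cay (gT : finGroupType) (S : {set gT}) :
  1%g \notin S -> (S^-1)%g = S -> simple_graph (Cay S).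
Proof.
move=> S1 SV; split=> [a b | a]; rewrite /Cay /=; last first.
  by rewrite mulgV (negbTE S1).
by rewrite -{1}SV inE invMg invgK.
Qed.

(* Main.v *)
Require Import Defs.
From mathcomp Require Import all_boot all_order all_algebra all_fingroup.
From mathcomp Require Import all_solvable all_field zify.

(** All Sylow subgroups of [G] are cyclic, and a group of odd order with cyclic
    Sylow subgroups is metacyclic by Hölder, Burnside and Zassenhaus.

    Let [P] be a noncyclic Sylow [p]-subgroup. If [#|P| > p ^ 2], let [M1] and
    [M2] be two maximal subgroups of [P] and let [S] be their symmetric
    difference. [Cay S] is a disjoint union of rook graphs in which every cell
    is blown up to a coset of [M1 :&: M2], so that every vertex has a twin.
    Godsil-McKay switching with respect to one vertex from each cell of a 2 x 2
    subgrid keeps the spectrum, but leaves a vertex without twin.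

    If [p > 3], then [P] contains [C_p x C_p], and the union [S] of three of its
    subgroups of order [p] makes [Cay S] a disjoint union of copies of the Latin
    square graph of [Z/p]. With [N] the point-line incidence matrix, the
    adjacency matrix is [N N^T - 3], and its spectrum is determined by [N^T N],
    which is the same for all Latin squares of order [p]. In the graph of [Z/p]
    every 4-clique extends to a 5-clique; replace one copy by the graph of a
    Latin square with a 2 x 2 subsquare, which is a 4-clique that does not. *)

Set Implicit Arguments.
Unset Strict Implicit.
Unset Printing Implicit Defensive.

(** * Cospectral graphs *)

Section Spectra.

Import GRing.Theory Num.Theory.
Local Open Scope ring_scope.

(** Sylvester's identity: one block matrix is made triangular by a right factor and by a left
    factor. The powers of [c] replace divisions, so that [c] may be ['X]. *)
Lemma det_block_mulmx (R : comUnitRingType) (m n : nat) (c : R)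
    (N : 'M[R]_(m, n)) (M : 'M[R]_(n, m)) :
  c ^+ n * \det (c%:M - N *m M) = c ^+ m * \det (c%:M - M *m N).
Proof.
have E1 : block_mx c%:M N M 1%:M *m block_mx 1%:M 0 (- M) 1%:M
        = block_mx (c%:M - N *m M) N 0 1%:M.
  by rewrite mulmx_block !mulmx1 !mulmx0 !mulmxN !mul1mx addrN !add0r.
have E2 : block_mx 1%:M 0 (- M) c%:M *m block_mx c%:M N M 1%:M
        = block_mx c%:M N 0 (c%:M - M *m N).
  rewrite mulmx_block !mul1mx !mul0mx !addr0 !mulNmx mulmx1 mul_mx_scalar.
  by rewrite mul_scalar_mx addNr addrC.
have := congr1 determinant E1; rewrite det_mulmx det_lblock !det1 !mulr1.
rewrite det_ublock det1 mulr1 => D1.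
have := congr1 determinant E2; rewrite det_mulmx det_lblock det1 mul1r D1.
by rewrite det_ublock !det_scalar.
Qed.

Lemma char_poly_mulmxC (F : fieldType) (m n : nat)
    (N : 'M[F]_(m, n)) (M : 'M[F]_(n, m)) :
  'X^n * char_poly (N *m M) = 'X^m * char_poly (M *m N).
Proof. by rewrite /char_poly /char_poly_mx !map_mxM det_block_mulmx. Qed.

Lemma char_poly_shift (R : comNzRingType) (n : nat) (c : R) (A : 'M[R]_n) :
  char_poly (A - c%:M) = char_poly A \Po ('X + c%:P).
Proof.
rewrite /char_poly -det_map_mx; congr (\det _); apply/matrixP=> i j.
rewrite !mxE /= comp_polyB comp_polyC polyCB polyCMn opprB.
case: (i == j); rewrite ?mulr1n ?mulr0n ?comp_polyX ?comp_poly0.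
  by rewrite addrA.
by rewrite !sub0r.
Qed.

Lemma char_poly_similar (F : fieldType) (n : nat) (Q A B : 'M[F]_n) :
  Q \in unitmx -> Q *m A = B *m Q -> char_poly A = char_poly B.
Proof.
move=> uQ QA; have uQX : map_mx polyC Q \in unitmx by rewrite map_unitmx.
apply: (mulrI (x := \det (map_mx polyC Q))).
  by rewrite -unitmxE.
rewrite /char_poly -det_mulmx mulrC -det_mulmx; congr (\det _).
rewrite /char_poly_mx mulmxBr mulmxBl mul_mx_scalar mul_scalar_mx.
by rewrite -!map_mxM QA.
Qed.

Lemma char_poly_cospectral (T : finType) (e f : rel T) :
  char_poly (adjacency_mx e) = char_poly (adjacency_mx f) -> cospectral e f.
Proof. by rewrite /cospectral /spectrum => ->. Qed.

(** * Point-line nets and their collinearity graphs *)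

Section Nets.

Variables (I V M : finType).

(** Points are the elements of [V], lines fall into parallel classes indexed by [I], and [l i v]
    labels the line of class [i] through [v]. *)
Definition collinear (l : I -> V -> M) : rel V :=
  [rel u v | (u != v) && [exists i, l i u == l i v]].

Definition pair_injective (l : I -> V -> M) : Prop :=
  forall i k u v, i != k -> l i u = l i v -> l k u = l k v -> u = v.

Definition net_mx (l : I -> V -> M) : 'M[algC]_(#|V|, #|{: I * M}|) :=
  \matrix_(u, k)
    (l (enum_val k).1 (enum_val u) == (enum_val k).2)%:R.

Lemma simple_collinear (l : I -> V -> M) : simple_graph (collinear l).
Proof.
split=> [u v | u]; rewrite /collinear /=; last by rewrite eqxx.
by rewrite eq_sym; congr (_ && _); apply: eq_existsb => i; rewrite eq_sym.
Qed.

(** Entry [(u, v)] of [N N^T] counts the classes in which [u] and [v] share a line: [#|I|] on the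
    diagonal, at most 1 off it. *)
Lemma adjacency_collinear (l : I -> V -> M) : pair_injective l ->
  adjacency_mx (collinear l) = net_mx l *m (net_mx l)^T - #|I|%:R%:M.
Proof.
move=> injl; apply/matrixP=> a b; rewrite !mxE.
under eq_bigr do rewrite !mxE.
rewrite -(big_enum_val (fun k => (l k.1 (enum_val a) == k.2)%:R
                              * (l k.1 (enum_val b) == k.2)%:R)) /=.
rewrite -(pair_bigA _ (fun i m => (l i (enum_val a) == m)%:R
                              * (l i (enum_val b) == m)%:R)) /=.
set u := enum_val a; set v := enum_val b.
have inner i : \sum_m (l i u == m)%:R * (l i v == m)%:R
             = (l i u == l i v)%:R :> algC.
  rewrite (bigD1 (l i u)) //= eqxx mul1r big1 ?addr0 1?eq_sym // => m.
  by rewrite eq_sym => /negPf->; rewrite mul0r.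
under eq_bigr do rewrite inner.
have [eq_ab|neq_ab] := eqVneq a b.
  have -> : v = u by rewrite /v -eq_ab.
  rewrite /collinear /= eqxx mulr1n; under eq_bigr do rewrite eqxx.
  by rewrite sumr_const subrr.
have neq_uv : u != v by apply: contra neq_ab => /eqP/enum_val_inj->.
rewrite /collinear /= -/u -/v neq_uv mulr0n subr0 /=.
case: existsP => [[i /eqP Ei]|noi].
  rewrite (bigD1 i) //= Ei eqxx big1 ?addr0 // => k neq_ki.
  case: eqP => // Ek; case/eqP: neq_uv; apply: injl Ei Ek.
  by rewrite eq_sym.
by rewrite big1 // => i _; case: eqP => // Ei; case: noi; exists i; apply/eqP.
Qed.

(** Up to a shift and powers of ['X], only [N^T N] matters, whose entries count the points common to
    two lines. The last hypothesis realizes in [l] every pair of lines of [l'] through a point. *)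
Theorem cospectral_nets (l l' : I -> V -> M) :
    (1 < #|I|)%N -> pair_injective l -> pair_injective l' ->
    (forall i k v, exists w, l i w = l' i v /\ l k w = l' k v) ->
  cospectral (collinear l) (collinear l').
Proof.
move=> I2 injl injl' real; apply: char_poly_cospectral.
rewrite !adjacency_collinear // !char_poly_shift; congr (_ \Po _).
have nzX n : 'X^n != 0 :> {poly algC} by rewrite monic_neq0 ?monicXn.
apply: (mulfI (nzX #|{: I * M}|)).
rewrite (char_poly_mulmxC (net_mx l)) (char_poly_mulmxC (net_mx l')).
congr (_ * char_poly _); apply/matrixP=> a b; rewrite !mxE.
under eq_bigr do rewrite !mxE; under [RHS]eq_bigr do rewrite !mxE.
case: (enum_val a) (enum_val b) => [i m] [k m'] /=.
rewrite -(big_enum_val (fun u => (l i u == m)%:R * (l k u == m')%:R)) /=.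
rewrite -(big_enum_val (fun u => (l' i u == m)%:R * (l' k u == m')%:R)) /=.
(* Choosing [w] for every [v] gives an injection, because two classes of [l'] determine a point; on
   the finite type [V] it is a permutation matching both classes at once. *)
have bij j : j != i -> exists2 h : V -> V, bijective h &
    forall v, l i (h v) = l' i v /\ l j (h v) = l' j v.
  move=> neq_ji; have [h Eh] := fin_all_exists (real i j); exists h => //.
  apply: injF_bij => u v Euv; apply: (injl' j i) => //.
    by rewrite -(Eh u).2 -(Eh v).2 Euv.
  by rewrite -(Eh u).1 -(Eh v).1 Euv.
have [->|neq_ki] := eqVneq k i.
  have [j neq_ji] : exists j, j != i.
    apply/existsP; apply: contraLR I2; rewrite negb_exists -leqNgt => /forallP alli.
    rewrite -(card1 i); apply/subset_leq_card/subsetP=> j _.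
    by rewrite inE; have := alli j; rewrite negbK.
  have [h bijh Eh] := bij _ neq_ji.
  rewrite (reindex h) /=; last exact: onW_bij.
  by apply: eq_bigr => v _; have [-> _] := Eh v.
have [h bijh Eh] := bij _ neq_ki.
rewrite (reindex h) /=; last exact: onW_bij.
by apply: eq_bigr => v _; have [-> ->] := Eh v.
Qed.

End Nets.

(** * Godsil-McKay switching *)

Section GodsilMcKay.

Variables (T : finType) (e : rel T) (C : {set T}).

Definition nbr_in (x : T) : nat := #|[set c in C | e x c]|.

Definition balanced (x : T) : bool := (x \notin C) && ((nbr_in x).*2 == #|C|).

Definition GM_switch : rel T :=
  [rel x y | e x y (+) ((x \in C) && balanced y || (y \in C) && balanced x)].

Lemma simple_GM_switch : simple_graph e -> simple_graph GM_switch.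
Proof.
case=> sym_e irr_e; split=> [x y | x]; rewrite /GM_switch /=.
  by rewrite sym_e orbC.
by rewrite irr_e /balanced; case: (x \in C).
Qed.

Let q (x y : T) : algC :=
  (if (x \in C) && (y \in C) then 2 / #|C|%:R else 0)
  + (if x \in C then -1 else 1) * (x == y)%:R.

Let qC x y : q x y = q y x.
Proof.
rewrite /q andbC eq_sym; congr (_ + _).
by have [->|] := eqVneq y x; rewrite // !mulr0.
Qed.

(** On [C] the matrix reflects a function in its mean: twice the mean over [C] minus the value. *)
Let sum_q x (F : T -> algC) :
  \sum_y q x y * F y =
  if x \in C then 2 / #|C|%:R * (\sum_(c in C) F c) - F x else F x.
Proof.
under eq_bigr do rewrite /q mulrDl.
rewrite big_split /= [X in _ + X](bigD1 x) //= eqxx mulr1.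
rewrite [X in _ + (_ + X)]big1 ?addr0; last first.
  by move=> y; rewrite eq_sym => /negPf->; rewrite mulr0 mul0r.
case: ifP => xC; last by rewrite big1 ?add0r ?mul1r // => y _; rewrite mul0r.
rewrite mulN1r; congr (_ - _); rewrite mulr_sumr [RHS]big_mkcond /=.
by apply: eq_bigr => y _; case: ifP; rewrite ?mul0r.
Qed.

Let Q : 'M[algC]_#|T| := \matrix_(a, b) q (enum_val a) (enum_val b).

Let nbr_inE (f : rel T) x :
  \sum_(c in C) (f x c)%:R = #|[set c in C | f x c]|%:R :> algC.
Proof.
rewrite -sum1_card natr_sum (eq_bigl (fun c => (c \in C) && f x c)).
  by rewrite [RHS]big_mkcondr /=; apply: eq_bigr => c _; case: (f x c).
by move=> c; rewrite inE.
Qed.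

(* The conjugating matrix is [2/#|C| J - 1] on [C] and the identity elsewhere. *)
Theorem cospectral_GM_switch :
    symmetric e -> C != set0 ->
    {in C &, forall x y, nbr_in x = nbr_in y} ->
    (forall x, x \notin C ->
       [\/ nbr_in x = 0%N, (nbr_in x).*2 = #|C| | nbr_in x = #|C| ]) ->
  cospectral e GM_switch.
Proof.
move=> sym_e nzC regC outC; have Cgt0 : (0 < #|C|)%N by rewrite card_gt0.
have nz : #|C|%:R != 0 :> algC by rewrite pnatr_eq0 -lt0n.
have sumqC y : \sum_(c in C) q c y = (y \in C)%:R.
  have [yC|yC] := boolP (y \in C).
    rewrite (eq_bigr (fun c => 2 / #|C|%:R - (c == y)%:R)); last first.
      by move=> c cC; rewrite /q cC yC mulN1r.
    rewrite sumrB sumr_const (bigD1 y) //= eqxx big1 ?addr0; last first.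
      by move=> c /andP[_ /negPf->].
    by rewrite -[_ *+ #|C|]mulr_natr divfK // -[2]/(1 + 1) addrK.
  rewrite big1 // => c cC; rewrite /q cC (negPf yC) /= add0r.
  by case: eqP yC => [<-|]; rewrite ?cC ?mulr0.
apply: char_poly_cospectral; apply: (@char_poly_similar _ _ Q).
  have /mulmx1_unit[] // : Q *m Q = 1%:M.
  apply/matrixP=> a b; rewrite !mxE; under eq_bigr do rewrite !mxE.
  rewrite -(big_enum_val (fun y => q (enum_val a) y * q y (enum_val b))) /=.
  rewrite sum_q sumqC /q (inj_eq enum_val_inj).
  case: (enum_val a \in C) => /=; last by rewrite add0r mul1r.
  by case: (_ \in C); rewrite ?mulr1 ?mulr0 mulN1r ?opprD opprK ?addKr ?subrr
    ?addrA ?subrr ?sub0r ?oppr0 ?add0r.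
apply/matrixP=> a b; rewrite !mxE.
under eq_bigr do rewrite !mxE; under [RHS]eq_bigr do rewrite !mxE.
set x := enum_val a; set y := enum_val b.
rewrite -(big_enum_val (fun z => q x z * (e z y)%:R)) /=.
rewrite -(big_enum_val (fun z => (GM_switch x z)%:R * q z y)) /=.
rewrite sum_q; under [RHS]eq_bigr do rewrite mulrC qC.
rewrite sum_q.
under eq_bigr do rewrite sym_e.
rewrite !nbr_inE -/(nbr_in y).
have GM_in u v : u \in C -> v \in C -> GM_switch u v = e u v.
  by move=> uC vC; rewrite /GM_switch /= /balanced uC vC /= addbF.
have half u : (nbr_in u).*2 = #|C| -> 2 / #|C|%:R * (nbr_in u)%:R = 1 :> algC.
  by move=> E; rewrite mulrAC -natrM mul2n E divff.
(* Inside [C] both sides agree by regularity. Between [C] and the outside, reflecting a 0/1 vector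
   with no, half or all entries 1 on [C] returns it, its complement, or itself: this is the
   switching. *)
have [xC|xC] := boolP (x \in C); have [yC|yC] := boolP (y \in C).
- rewrite GM_in // (regC _ _ yC xC); congr (_ * _%:R - _).
  by apply: eq_card => c; rewrite !inE; case: (boolP (c \in C)) => //= cC;
    rewrite GM_in.
- rewrite /GM_switch /= xC /balanced yC (negPf yC) /= orbF.
  have [E|E|E] := outC y yC.
  + rewrite E mulr0 sub0r (negPf (contraTneq _ (lt0n_neq0 Cgt0))); last first.
      by move=> <-.
    suff -> : e x y = false by rewrite oppr0.
    move/eqP: E; rewrite cards_eq0 => /eqP/setP/(_ x).
    by rewrite !inE xC sym_e.
  + rewrite half // E eqxx addbT; case: (e x y); rewrite ?subrr ?subr0 //.
  + rewrite E divfK // -mul2n gtn_eqF /=; last first.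
      by rewrite -[X in (X < _)%N]mul1n ltn_mul2r Cgt0.
    have /setP/(_ x) : [set c in C | e y c] = C.
      apply/eqP; rewrite eqEcard /= -/(nbr_in y) E leqnn andbT.
      by apply/subsetP=> c; rewrite inE => /andP[].
    by rewrite inE xC sym_e /= => ->; rewrite -[2]/(1 + 1) addrK.
- have GM_xc c : c \in C -> GM_switch x c = e x c (+) ((nbr_in x).*2 == #|C|).
    by move=> cC; rewrite /GM_switch /= cC /balanced (negPf xC) cC.
  have -> : #|[set c in C | GM_switch x c]|
          = #|[set c in C | e x c (+) ((nbr_in x).*2 == #|C|)]|.
    by apply: eq_card => c; rewrite !inE; case: (boolP (c \in C)) => //= cC;
      rewrite GM_xc.
  rewrite GM_xc //; have [E|E|E] := outC x xC.
  + rewrite E (negPf (contraTneq _ (lt0n_neq0 Cgt0))); last first.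
      by move=> <-.
    have /eqP : #|[set c in C | e x c]| = 0%N by [].
    rewrite cards_eq0 => /eqP E0.
    have -> : #|[set c in C | e x c (+) false]| = 0%N.
      by rewrite -[RHS](cards0 T) -E0; apply: eq_card => c; rewrite !inE addbF.
    rewrite mulr0 sub0r addbF; suff -> : e x y = false by rewrite oppr0.
    by move/setP/(_ y): E0; rewrite !inE yC.
  + rewrite E eqxx addbT.
    have -> : #|[set c in C | e x c (+) true]| = nbr_in x.
      apply: (@addnI (nbr_in x)); rewrite addnn E.
      rewrite -[RHS](cardsID [set c | e x c] C); congr (_ + _)%N;
        by apply: eq_card => c; rewrite !inE ?addbT // andbC.
    by rewrite half //; case: (e x y); rewrite ?subrr ?subr0.
  + rewrite gtn_eqF; last first.
      by rewrite -E -mul2n -[X in (X < _)%N]mul1n ltn_mul2r E Cgt0.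
    have EC : [set c in C | e x c] = C.
      apply/eqP; rewrite eqEcard /= -/(nbr_in x) E leqnn andbT.
      by apply/subsetP=> c; rewrite inE => /andP[].
    have -> : #|[set c in C | e x c (+) false]| = #|C|.
      by rewrite -[in RHS]EC; apply: eq_card => c; rewrite !inE addbF.
    rewrite divfK // addbF; move/setP/(_ y): EC; rewrite inE yC /= => ->.
    by rewrite -[2]/(1 + 1) addrK.
- by rewrite /GM_switch /= (negPf xC) (negPf yC) addbF.
Qed.

End GodsilMcKay.

End Spectra.

(** * Switching a blown-up rook graph *)

Lemma eq_cospectral (T U : finType) (e e' : rel T) (f : rel U) :
  e =2 e' -> cospectral e' f -> cospectral e f.
Proof.
move=> eqe; rewrite /cospectral /spectrum.
have -> // : adjacency_mx e = adjacency_mx e'.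
by apply/matrixP=> i j; rewrite !mxE eqe.
Qed.

Section GridSwitch.

Variables (T : finType) (D D' : eqType) (r : T -> D) (c : T -> D').

(** The exclusive or leaves two points of one cell, sharing row and column, nonadjacent with equal
    neighbourhoods. *)
Definition grid_graph : rel T :=
  [rel x y | (r x == r y) (+) (c x == c y)].

(** [o], [a], [b], [d] are the corners of a 2 x 2 subgrid, [a] in the row and [b] in the column of
    [o]. [f] is in the row of [b] and [d] and a third column, [g] in the column of [a] and [d] and a
    third row. *)
Variables o a b d f g : T.
Hypotheses (r_a : r a = r o) (c_b : c b = c o).
Hypotheses (r_d : r d = r b) (c_d : c d = c a).
Hypotheses (r_b : r b != r o) (c_a : c a != c o).
Hypotheses (r_f : r f = r b) (c_fo : c f != c o) (c_fa : c f != c a).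
Hypotheses (c_g : c g = c a) (r_go : r g != r o) (r_gb : r g != r b).

Let C : {set T} := [set x in [:: o; a; b; d]].

Let uniqC : uniq [:: o; a; b; d].
Proof.
have noa : o != a by apply: contra c_a => /eqP<-.
have nob : o != b by apply: contra r_b => /eqP<-.
have nod : o != d by apply: contra r_b => /eqP->; rewrite r_d.
have nab : a != b by apply: contra c_a => /eqP->; rewrite c_b.
have nad : a != d by apply: contra r_b; rewrite -r_a => /eqP->; rewrite r_d.
have nbd : b != d by apply: contra c_a; rewrite -c_b -c_d => /eqP->.
by rewrite /= !inE !negb_or noa nob nod nab nad nbd.
Qed.

Let cardC : #|C| = 4.
Proof. by rewrite cardsE; apply/card_uniqP: uniqC. Qed.

Let nbrE x : nbr_in grid_graph C x = count (grid_graph x) [:: o; a; b; d].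
Proof.
rewrite -size_filter -(card_uniqP (filter_uniq (grid_graph x) uniqC)).
by apply: eq_card => y; rewrite !inE mem_filter !inE andbC.
Qed.

(* A vertex lies in at most one of the two rows and at most one of the two
   columns through the four corners. *)
Let nbr_cases x : nbr_in grid_graph C x =
  if [|| r x == r o, r x == r b, c x == c o | c x == c a] then 2 else 0.
Proof.
rewrite nbrE /= /grid_graph /= r_a c_b r_d c_d.
have [r_b' c_a'] : r o != r b /\ c o != c a by rewrite eq_sym r_b eq_sym c_a.
have [->|] := eqVneq (r x) (r o); last have [->|] := eqVneq (r x) (r b);
  (have [->|] := eqVneq (c x) (c o); last have [->|] := eqVneq (c x) (c a));
  by rewrite ?(negPf c_a) ?(negPf c_a') ?(negPf r_b) ?(negPf r_b').
Qed.

Lemma cospectral_grid_switch :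
  cospectral grid_graph (GM_switch grid_graph C).
Proof.
apply: cospectral_GM_switch.
- by move=> x y; rewrite /grid_graph /= eq_sym [c x == _]eq_sym.
- by rewrite -card_gt0 cardC.
- have nbrC x : x \in C -> nbr_in grid_graph C x = 2.
    rewrite nbr_cases !inE.
    by case/or4P=> /eqP->; rewrite ?r_a ?r_d eqxx ?orbT.
  by move=> x y xC yC; rewrite !nbrC.
- by move=> x _; rewrite nbr_cases cardC; case: ifP; [constructor 2|constructor 1].
Qed.

(** After switching, [o] is adjacent to [a], [b], [f] and [g]. In [C], neither [a] nor [b] is
    adjacent to itself, and [d] has lost [f]. Outside [C], adjacency to both [a] and [b] forces [v]
    into the cell of [a] or of [b], where it misses [f] or [g]. *)
Lemma grid_switch_no_twin v : v != o ->
  exists u, GM_switch grid_graph C o u != GM_switch grid_graph C v u.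
Proof.
move=> nvo; have oC : o \in C by rewrite !inE eqxx.
have aC : a \in C by rewrite !inE eqxx !orbT.
have bC : b \in C by rewrite !inE eqxx !orbT.
have dC : d \in C by rewrite !inE eqxx !orbT.
have fC : f \notin C.
  rewrite !inE !negb_or; apply/and4P; split.
  - by apply: contra c_fo => /eqP->.
  - by apply: contra c_fa => /eqP->.
  - by apply: contra c_fo => /eqP->; rewrite c_b.
  - by apply: contra c_fa => /eqP->; rewrite c_d.
have gC : g \notin C.
  rewrite !inE !negb_or; apply/and4P; split.
  - by apply: contra r_go => /eqP->.
  - by apply: contra r_go => /eqP->; rewrite r_a.
  - by apply: contra r_gb => /eqP->.
  - by apply: contra r_gb => /eqP->; rewrite r_d.
have balE x : balanced grid_graph C x = (x \notin C) &&
    [|| r x == r o, r x == r b, c x == c o | c x == c a].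
  by rewrite /balanced nbr_cases cardC; case: ifP.
have balf : balanced grid_graph C f by rewrite balE fC r_f eqxx orbT.
have balg : balanced grid_graph C g by rewrite balE gC c_g eqxx !orbT.
have [r_b' c_a'] : r o != r b /\ c o != c a by rewrite eq_sym r_b eq_sym c_a.
have [c_fo' r_go'] : c o != c f /\ r o != r g by rewrite eq_sym c_fo eq_sym r_go.
have of1 : GM_switch grid_graph C o f.
  by rewrite /GM_switch /= /grid_graph /= oC balf r_f (negPf r_b') (negPf c_fo').
have og1 : GM_switch grid_graph C o g.
  by rewrite /GM_switch /= /grid_graph /= oC balg c_g (negPf c_a') (negPf r_go').
have oa1 : GM_switch grid_graph C o a.
  by rewrite /GM_switch /= /grid_graph /= oC aC r_a eqxx (negPf c_a') !balE oC aC.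
have ob1 : GM_switch grid_graph C o b.
  by rewrite /GM_switch /= /grid_graph /= oC bC c_b eqxx (negPf r_b') !balE oC bC.
have irr x : GM_switch grid_graph C x x = false.
  by rewrite /GM_switch /= /grid_graph /= !eqxx /balanced; case: (x \in C).
have [|vC] := boolP (v \in C).
  rewrite !inE (negPf nvo) /=; case/or3P=> /eqP->.
  - by exists a; rewrite oa1 irr.
  - by exists b; rewrite ob1 irr.
  exists f; rewrite of1 /GM_switch /= /grid_graph /= dC balf r_f r_d eqxx c_d.
  by rewrite [c a == _]eq_sym (negPf c_fa).
have [va|va] := boolP (GM_switch grid_graph C v a); last first.
  by exists a; rewrite oa1 (negPf va).
have [vb|vb] := boolP (GM_switch grid_graph C v b); last first.
  by exists b; rewrite ob1 (negPf vb).
have outE u : u \notin C -> GM_switch grid_graph C v u = grid_graph v u.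
  by move=> uC; rewrite /GM_switch /= (negPf uC) (negPf vC) addbF.
rewrite /GM_switch /= aC bC (negPf vC) (balE v) vC /= /grid_graph /= in va vb.
rewrite r_a c_b in va vb; move: va vb.
have [rvo|rvo] := eqVneq (r v) (r o).
  rewrite rvo (negPf r_b') /=; case: eqP => [cva|_] //= _ _.
  exists f; rewrite of1 outE // /grid_graph /= rvo cva r_f (negPf r_b').
  by rewrite [c a == _]eq_sym (negPf c_fa).
have [rvb|rvb] := eqVneq (r v) (r b).
  rewrite /=; have [cvo|//] := eqVneq (c v) (c o); move=> _ _.
  exists g; rewrite og1 outE // /grid_graph /= rvb cvo c_g (negPf c_a').
  by rewrite [r b == _]eq_sym (negPf r_gb).
by case: (c v == c o); case: (c v == c a).
Qed.

End GridSwitch.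


Import GroupScope.

(** * Noncyclic p-subgroups of order above p ^ 2 *)

Lemma eq_rcosetE (gT : finGroupType) (M : {group gT}) (x y : gT) :
  (M :* x == M :* y) = (x * y^-1 \in M).
Proof. by rewrite -mem_rcoset; apply/eqP/rcoset_eqP. Qed.

(** Rows are cosets of [M1] and columns cosets of [M2], so [z * x] is a twin of [x] for every [x] in
    the Cayley graph, while [1] has no twin in the switched graph. *)
Lemma DS_grid_false (gT : finGroupType) (M1 M2 : {group gT}) (a b z : gT) :
    DS_group gT ->
    a \in M1 -> a \notin M2 -> a ^+ 2 \notin M2 -> a \in 'N(M2) ->
    b \in M2 -> b \notin M1 -> b ^+ 2 \notin M1 ->
    z \in M1 :&: M2 -> z != 1 ->
  False.
Proof.
move=> DS aM1 aM2 a2M2 aN bM2 bM1 b2M1 /setIP[zM1 zM2] nz1.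
pose S := [set s | (s \in M1) (+) (s \in M2)].
pose r (x : gT) := M1 :* x; pose c (x : gT) := M2 :* x.
pose e : rel gT := grid_graph r c.
pose e' := GM_switch e [set x in [:: 1; a; b; a * b]].
have CayE : Cay S =2 e.
  by move=> x y; rewrite /Cay /e /grid_graph /= inE !eq_rcosetE.
have nS1 : 1 \notin S by rewrite inE !group1.
have SV : S^-1 = S by apply/setP=> x; rewrite !inE !groupV.
(* This puts [a * b] and [a * b ^+ 2] in the column of [a]. *)
have abV : a * b * a^-1 \in M2.
  by rewrite -[a * b * _]/(a * b * a^-1) -{1}[a]invgK -mulgA -conjgE
    memJ_norm ?groupV.
have r_a : M1 :* a = M1 :* 1 by apply/eqP; rewrite eq_rcosetE invg1 mulg1.
have c_b : M2 :* b = M2 :* 1 by apply/eqP; rewrite eq_rcosetE invg1 mulg1.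
have r_d : M1 :* (a * b) = M1 :* b by apply/eqP; rewrite eq_rcosetE mulgK.
have c_d : M2 :* (a * b) = M2 :* a by apply/eqP; rewrite eq_rcosetE.
have r_b : M1 :* b != M1 :* 1 by rewrite eq_rcosetE invg1 mulg1.
have c_a : M2 :* a != M2 :* 1 by rewrite eq_rcosetE invg1 mulg1.
have r_f : M1 :* (a ^+ 2 * b) = M1 :* b.
  by apply/eqP; rewrite eq_rcosetE mulgK groupX.
have c_fo : M2 :* (a ^+ 2 * b) != M2 :* 1.
  by rewrite eq_rcosetE invg1 mulg1 groupMr.
have c_fa : M2 :* (a ^+ 2 * b) != M2 :* a.
  by rewrite eq_rcosetE expgS expg1 -!mulgA (mulgA a b) groupMr.
have c_g : M2 :* (a * b ^+ 2) = M2 :* a.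
  apply/eqP; rewrite eq_rcosetE expgS expg1.
  have -> : a * (b * b) * a^-1 = (a * b * a^-1) * (a * b * a^-1).
    by rewrite !mulgA mulgKV.
  by rewrite groupM.
have r_go : M1 :* (a * b ^+ 2) != M1 :* 1 by rewrite eq_rcosetE invg1 mulg1 groupMl.
have r_gb : M1 :* (a * b ^+ 2) != M1 :* b.
  by rewrite eq_rcosetE expgS expg1 !mulgA mulgK groupMl.
have cosp : cospectral e e' :=
  @cospectral_grid_switch gT _ _ r c 1 a b (a * b) r_a c_b r_d c_d r_b c_a.
have notwin v : v != 1 -> exists u, e' 1 u != e' v u :=
  @grid_switch_no_twin gT _ _ r c 1 a b (a * b) _ _
    r_a c_b r_d c_d r_b c_a r_f c_fo c_fa c_g r_go r_gb v.
have simpe' : simple_graph e'.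
  apply: simple_GM_switch; have [sym irr] := simple_graph_Cay nS1 SV.
  by split=> [x y | x]; rewrite -!CayE; [apply: sym | apply: irr].
have [h [h' hK h'K] hE] := DS S nS1 SV _ _ simpe' (eq_cospectral CayE cosp).
(* [h] carries the twin [z * x] of [x] to a vertex other than [1] with the neighbours of [1]. *)
pose x := h' 1; have ne1 : h (z * x) != 1.
  by rewrite -(h'K 1) (can_eq hK) -/x -[x in _ != x]mul1g (inj_eq (mulIg x)).
have [u] := notwin _ ne1; rewrite -{1}[1]h'K -/x -[u]h'K !hE !CayE.
rewrite /e /grid_graph /= /r /c !eq_rcosetE -mulgA (groupMl _ zM1) (groupMl _ zM2).
by rewrite eqxx.
Qed.

(** On [<[x]>] squaring is inverted by the power of exponent half of [#[x] + 1]. *)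
Lemma odd_order_sqrt_mem (gT : finGroupType) (M : {group gT}) (x : gT) :
  odd #[x] -> x ^+ 2 \in M -> x \in M.
Proof.
move=> oddx x2M; suff -> : x = (x ^+ 2) ^+ uphalf #[x] by rewrite groupX.
by rewrite -expgM mul2n uphalfE even_halfK ?oddS ?oddx //= expgS expg_order mulg1.
Qed.

(** An element [x] outside a first maximal subgroup generates a proper subgroup, as [P] is not
    cyclic; a maximal subgroup above [<[x]>] is the second. *)
Lemma noncyclic_pgroup_two_maximals (gT : finGroupType) (p : nat)
    (P : {group gT}) :
    p.-group P -> ~~ cyclic P ->
  exists M1 M2 : {group gT},
    [/\ maximal M1 P, maximal M2 P & ~~ (M2 \subset M1)].
Proof.
move=> pP ncP; have ntP : P != 1%G.
  by apply: contra ncP => /eqP->; rewrite cyclic1.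
have [P1|[M1 maxM1 _]] := maximal_exists (sub1G P).
  by case/eqP: ntP; apply/val_inj; rewrite /= -P1.
have /andP[_ /subsetPn[x Px M1x]] := maxgroupp maxM1.
have sxP : <[x]>%G \subset P by rewrite cycle_subG.
have [xP|[M2 maxM2 sxM2]] := maximal_exists sxP.
  by case/negP: ncP; rewrite -xP cycle_cyclic.
exists M1, M2; split=> //; apply/subsetPn; exists x => //.
by rewrite -cycle_subG.
Qed.

Lemma DS_pgroup_card_leq (gT : finGroupType) (p : nat) (P : {group gT}) :
    DS_group gT -> prime p -> odd p -> p.-group P -> ~~ cyclic P ->
  #|P| <= p ^ 2.
Proof.
move=> DS pr_p odd_p pP ncP; rewrite leqNgt; apply/negP=> gt_p2.
have [M1 [M2 [maxM1 maxM2 /subsetPn[b M2b M1b]]]] :=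
  noncyclic_pgroup_two_maximals pP ncP.
have [ns1 ns2] := (p_maximal_normal pP maxM1, p_maximal_normal pP maxM2).
have [s1 s2] := (normal_sub ns1, normal_sub ns2).
have p_gt0 := prime_gt0 pr_p.
have card1 : #|P| = (#|M1| * p)%N.
  by rewrite -(Lagrange s1) (p_maximal_index pP maxM1).
have card2 : #|P| = (#|M2| * p)%N.
  by rewrite -(Lagrange s2) (p_maximal_index pP maxM2).
have oddP x : x \in P -> odd #[x].
  move=> Px; have [|k ->] := @p_natP p #[x]; last by rewrite oddX odd_p orbT.
  exact: mem_p_elt pP Px.
have /subsetPn[a M1a M2a] : ~~ (M1 \subset M2).
  apply: contra M1b => sM12; suff -> : M1 :=: M2 by [].
  apply/eqP; rewrite eqEcard sM12 /= -(leq_pmul2r p_gt0).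
  by rewrite -card1 -card2.
have defP : M1 * M2 = P.
  have /maxgroupP[_ max1] := maxM1; apply/eqP; rewrite eqEsubset mul_subG //=.
  rewrite -norm_joinEr ?(subset_trans s2 (normal_norm ns1)) //.
  have [//|sMP] := boolP (P \subset _); case/negP: M1b.
  rewrite -(max1 (M1 <*> M2)%G) ?joing_subl //.
    by rewrite (subsetP (joing_subr _ _)).
  by rewrite properE join_subG s1 s2.
(* Both subgroups have index [p] and their product is [P], so the intersection has order
   [#|P| / p ^ 2]. *)
have ntI : M1 :&: M2 != 1.
  have ltp : p < #|M2| by rewrite -(ltn_pmul2r p_gt0) -card2 mulnn.
  rewrite -cardG_gt1 ltnNge; apply/negP=> I1.
  have : #|M1| * #|M2| <= #|M1| * p.
    by rewrite mul_cardG defP card1 -[leqRHS]muln1 leq_mul.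
  by rewrite leq_pmul2l ?cardG_gt0 // leqNgt ltp.
have [z Iz nz1] := trivgPn _ ntI.
have [Pa Pb] := (subsetP s1 _ M1a, subsetP s2 _ M2b).
apply: (@DS_grid_false gT M1 M2 a b z) => //.
- by apply: contra M2a; apply/odd_order_sqrt_mem/oddP.
- exact: (subsetP (normal_norm ns2)).
- by apply: contra M1b; apply/odd_order_sqrt_mem/oddP.
Qed.

Lemma abelem_Z3xZ3 : 3.-abelem [set: 'Z_3 * 'Z_3].
Proof.
apply/abelemP=> //; split.
  by apply/centsP=> -[a b] _ [c d] _; congr (_, _); apply: GRing.addrC.
by case=> [[[|[|[|a]]] lta] [[|[|[|b]]] ltb]] _ //; apply/eqP.
Qed.

Lemma noncyclic_order9_isog (gT : finGroupType) (P : {group gT}) :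
  3.-group P -> ~~ cyclic P -> #|P| <= 9 -> P \isog [set: 'Z_3 * 'Z_3].
Proof.
move=> pP; have odd_P : odd #|P|.
  by have [k ->] := p_natP pP; rewrite oddX orbT.
rewrite (odd_pgroup_rank1_cyclic pP odd_P) -ltnNge => /p_rank_geP[E].
case/pnElemPcard=> sEP abE cardE leP9.
have <- : E :=: P by apply/eqP; rewrite eqEcard sEP cardE.
rewrite (isog_abelem_card _ abE) abelem_Z3xZ3 cardE /=.
by rewrite cardsT card_prod !card_ord.
Qed.

(** * A Latin square with a 2 x 2 subsquare *)

(** Column [i] permutes the rows 0, 1, 2: trivially for even [i], exchanging 0 and 2 for odd [i]. As
    [p] is odd, this alternation does not close up cyclically, so the last two columns take the two
    3-cycles. *)
Definition twist (p i d : nat) : nat :=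
  if 2 < d then d else if i == p.-1 then d.+1 %% 3
  else if i == p.-2 then (d + 2) %% 3 else if odd i then 2 - d else d.

(* The Cayley table of Z/p (row [j - i] at column [i] and symbol [j]) in which
   the rows 0, 1, 2 are recombined; columns 0, 1 and symbols 1, 2 then meet in
   a 2 x 2 subsquare, which the table of Z/p does not contain. *)
Definition latin_row (p i j : nat) : nat :=
  twist p i (if i <= j then j - i else j + p - i).

Lemma latin_row_lt (p i j : nat) :
  4 < p -> i < p -> j < p -> latin_row p i j < p.
Proof.
by rewrite /latin_row; case: (leqP i j) => ?; rewrite /twist;
  do !case: ifP => ?; lia.
Qed.

Lemma latin_row_inj_symbol (p i j j' : nat) :
    4 < p -> i < p -> j < p -> j' < p ->
  latin_row p i j = latin_row p i j' -> j = j'.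
Proof.
rewrite /latin_row; case: (leqP i j) => ?; case: (leqP i j') => ?;
  by rewrite /twist; do !case: ifP => ?; lia.
Qed.

(** In the cyclic table symbol [j] meets rows 0, 1, 2 in columns [j], [j - 1], [j - 2] modulo [p];
    the permutations of these columns send it to three distinct rows. *)
Lemma latin_row_inj_column (p i i' j : nat) :
    4 < p -> odd p -> i < p -> i' < p -> j < p ->
  latin_row p i j = latin_row p i' j -> i = i'.
Proof.
rewrite /latin_row; case: (leqP i j) => ?; case: (leqP i' j) => ?;
  by rewrite /twist; do !case: ifP => ?; lia.
Qed.

(** * The coset net of C_p x C_p and its Latin square variant *)

Section LatinNet.

Variables (gT : finGroupType) (p : nat) (x y : gT).
Hypotheses (p_gt4 : 4 < p) (odd_p : odd p).
Hypotheses (ox : #[x] = p) (oy : #[y] = p) (cxy : commute x y).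
Hypothesis tiXY : <[x]> :&: <[y]> = 1.

Let p_gt0 : 0 < p := ltn_trans (isT : 0 < 4) p_gt4.

(** Cosets of these fix the second exponent, the first, or their difference: the symbol, column and
    row of a cell. Every index from 2 on gives the diagonal, hence the bounds [i < 3] below. *)
Definition direction (n : nat) : {group gT} :=
  match n with 0 => <[x]>%G | 1 => <[y]>%G | _ => <[x * y]>%G end.

Let expxy k : (x * y) ^+ k = x ^+ k * y ^+ k.
Proof. by rewrite expgMn. Qed.

Let comm_exp i j : y ^+ j * x ^+ i = x ^+ i * y ^+ j.
Proof. by apply/esym/commuteX/commute_sym/commuteX/commute_sym. Qed.

Let xy_inj i j i' j' : x ^+ i * y ^+ j = x ^+ i' * y ^+ j' ->
  x ^+ i = x ^+ i' /\ y ^+ j = y ^+ j'.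
Proof.
move=> E; have Ex : (x ^+ i')^-1 * x ^+ i = y ^+ j' * (y ^+ j)^-1.
  by apply: (mulIg (y ^+ j)); rewrite mulgKV -mulgA E mulKg.
have : (x ^+ i')^-1 * x ^+ i \in <[x]> :&: <[y]>.
  by rewrite inE {2}Ex !groupM ?groupV ?mem_cycle.
rewrite tiXY => /set1P E1; rewrite E1 in Ex.
split; first by apply/eqP; rewrite eq_sym eq_mulVg1 E1.
by apply/eqP; rewrite eq_sym eq_mulgV1 -Ex.
Qed.

Let expy_inj i j : i < p -> j < p -> y ^+ i = y ^+ j -> i = j.
Proof.
by move=> lti ltj /eqP; rewrite eq_expg_mod_order oy !modn_small // => /eqP.
Qed.

Let expx_inj i j : i < p -> j < p -> x ^+ i = x ^+ j -> i = j.
Proof.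
by move=> lti ltj /eqP; rewrite eq_expg_mod_order ox !modn_small // => /eqP.
Qed.

Let exp_xyP i : (x ^+ i == 1) = (y ^+ i == 1).
Proof. by rewrite -!order_dvdn ox oy. Qed.

Let tiXZ : <[x]> :&: <[x * y]> = 1.
Proof.
apply/trivgP/subsetP=> _ /setIP[/cycleP[i ->] /cycleP[k]].
rewrite expxy -[x ^+ i]mulg1 -(expg0 y) => /xy_inj[-> /esym/eqP].
by rewrite expg0 mulg1 -exp_xyP inE.
Qed.

Let tiYZ : <[y]> :&: <[x * y]> = 1.
Proof.
apply/trivgP/subsetP=> _ /setIP[/cycleP[i ->] /cycleP[k]].
rewrite expxy -[y ^+ i]mul1g -(expg0 x) => /xy_inj[/esym/eqP + ->].
by rewrite expg0 mul1g exp_xyP inE.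
Qed.

Lemma direction_TI i k : i < 3 -> k < 3 -> i != k ->
  direction i :&: direction k = 1.
Proof.
by case: i k => [|[|[|i]]] [|[|[|k]]] //= _ _ _; rewrite // setIC.
Qed.

Let coord (v : gT) : option ('I_p * 'I_p) :=
  [pick ij : 'I_p * 'I_p | v == x ^+ ij.1 * y ^+ ij.2].

(** A representative of the third line through [v]. In the coset net [x ^+ i * y ^+ j] is in row
    [j - i] modulo [p]; here its row is read off the Latin square. Points outside [<[x]> * <[y]>]
    keep their lines, so only one copy is replaced. *)
Let lastpt (v : gT) : gT :=
  if coord v is Some ij then y ^+ latin_row p ij.1 ij.2 else v.

Definition coset_net (i : 'I_3) (v : gT) : {set gT} := direction i :* v.

Definition latin_net (i : 'I_3) (v : gT) : {set gT} :=
  direction i :* (if i < 2 then v else lastpt v).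

Lemma lastptP v :
  (exists i j : nat, [/\ v = x ^+ i * y ^+ j, i < p, j < p
     & lastpt v = y ^+ latin_row p i j]) \/
  (v \notin <[x]> * <[y]> /\ lastpt v = v).
Proof.
rewrite /lastpt /coord; case: pickP => [[i j] /= /eqP Ev|nov].
  by left; exists i, j.
right; split=> //; apply/negP=> /mulsgP[a b /cyclePmin[i lti ->]].
case/cyclePmin=> j ltj -> Ev; rewrite ox in lti; rewrite oy in ltj.
by have /eqP[] := nov (Ordinal lti, Ordinal ltj).
Qed.

Lemma lastpt_exp i j : i < p -> j < p ->
  lastpt (x ^+ i * y ^+ j) = y ^+ latin_row p i j.
Proof.
move=> lti ltj; case: (lastptP (x ^+ i * y ^+ j)) => [|[/negP[]]]; last first.
  by rewrite mem_mulg ?mem_cycle.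
case=> i' [j' [/xy_inj[/expx_inj Ei /expy_inj Ej] lti' ltj' ->]].
by rewrite (Ei lti lti') (Ej ltj ltj').
Qed.

Lemma coset_net_inj : pair_injective coset_net.
Proof.
move=> i k u v neq_ik /eqP + /eqP; rewrite !eq_rcosetE => Hi Hk.
have : u * v^-1 \in direction i :&: direction k by rewrite inE Hi.
rewrite direction_TI ?ltn_ord // => /set1P E.
by apply/eqP; rewrite eq_mulgV1 E.
Qed.

(** [<[x * y]>] lies in [<[x]> * <[y]>], so no line of the third class joins the replaced copy to
    the rest. *)
Let rowE u v : direction 2 :* lastpt u = direction 2 :* lastpt v ->
  (u \in <[x]> * <[y]>) = (v \in <[x]> * <[y]>).
Proof.
have cXY : <[x]> * <[y]> = <[x]> <*> <[y]>.
  rewrite cent_joinEr //; apply/centsP=> _ /cycleP[j ->] _ /cycleP[i ->].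
  exact: comm_exp.
have subZ : direction 2 \subset <[x]> <*> <[y]>.
  by rewrite cycle_subG groupM // mem_gen // inE cycle_id ?orbT.
have mem w : (lastpt w \in <[x]> * <[y]>) = (w \in <[x]> * <[y]>).
  have [[i [j [-> _ _ ->]]]|[_ ->]] := lastptP w => //.
  by rewrite mem_mulg ?mem_cycle // -[y ^+ _]mul1g mem_mulg ?mem_cycle ?group1.
rewrite -(mem u) -(mem v) cXY => /eqP; rewrite eq_rcosetE => /(subsetP subZ) E.
by rewrite -[lastpt u](mulgKV (lastpt v)) groupMl.
Qed.

Let rowE_in i j i' j' : i < p -> j < p -> i' < p -> j' < p ->
  direction 2 :* y ^+ latin_row p i j = direction 2 :* y ^+ latin_row p i' j' ->
  latin_row p i j = latin_row p i' j'.
Proof.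
move=> lti ltj lti' ltj' /eqP; rewrite eq_rcosetE => Z.
have : y ^+ latin_row p i j * (y ^+ latin_row p i' j')^-1 \in <[y]> :&: <[x * y]>.
  by rewrite inE Z groupM ?groupV ?mem_cycle.
rewrite tiYZ => /set1P E; apply: expy_inj; rewrite ?latin_row_lt //.
by apply/eqP; rewrite eq_mulgV1 E.
Qed.

Let latin_inj02 u v : direction 0 :* u = direction 0 :* v ->
  direction 2 :* lastpt u = direction 2 :* lastpt v -> u = v.
Proof.
move=> E0 E2; have := rowE E2.
have [[i [j [Eu lti ltj Lu]]]|[/negPf-> Lu]] := lastptP u; last first.
  have [[i' [j' [-> _ _ _]]]|[_ Lv]] := lastptP v.
    by rewrite mem_mulg ?mem_cycle.
  move=> _; rewrite Lu Lv in E2.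
  by apply: (coset_net_inj (i := @Ordinal 3 0 isT) (k := @Ordinal 3 2 isT)).
have [[i' [j' [Ev lti' ltj' Lv]]]|[/negPf-> _]] := lastptP v; last first.
  by rewrite Eu mem_mulg ?mem_cycle.
move=> _; rewrite Lu Lv in E2; have {}E2 := rowE_in lti ltj lti' ltj' E2.
have /mulsgP : u \in direction 0 :* v by rewrite -E0 rcoset_refl.
case=> w _ /cycleP[k ->] /set1P-> Euv.
have Ejj : j = j'.
  move: Euv; rewrite Eu Ev mulgA -expgD => /xy_inj[_]; exact: expy_inj.
by rewrite Eu Ev -Ejj (latin_row_inj_column p_gt4 odd_p lti lti' ltj) ?E2 ?Ejj.
Qed.

Let latin_inj12 u v : direction 1 :* u = direction 1 :* v ->
  direction 2 :* lastpt u = direction 2 :* lastpt v -> u = v.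
Proof.
move=> E0 E2; have := rowE E2.
have [[i [j [Eu lti ltj Lu]]]|[/negPf-> Lu]] := lastptP u; last first.
  have [[i' [j' [-> _ _ _]]]|[_ Lv]] := lastptP v.
    by rewrite mem_mulg ?mem_cycle.
  move=> _; rewrite Lu Lv in E2.
  by apply: (coset_net_inj (i := @Ordinal 3 1 isT) (k := @Ordinal 3 2 isT)).
have [[i' [j' [Ev lti' ltj' Lv]]]|[/negPf-> _]] := lastptP v; last first.
  by rewrite Eu mem_mulg ?mem_cycle.
move=> _; rewrite Lu Lv in E2; have {}E2 := rowE_in lti ltj lti' ltj' E2.
have /mulsgP : u \in direction 1 :* v by rewrite -E0 rcoset_refl.
case=> w _ /cycleP[k ->] /set1P-> Euv.
have Eii : i = i'.
  move: Euv; rewrite Eu Ev mulgA comm_exp -mulgA -expgD => /xy_inj[+ _].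
  exact: expx_inj.
by rewrite Eu Ev -Eii (latin_row_inj_symbol p_gt4 lti ltj ltj') ?E2 ?Eii.
Qed.

Lemma latin_net_inj : pair_injective latin_net.
Proof.
move=> i k u v; rewrite /latin_net.
case: i k => [[|[|[|i]]] lti] [[|[|[|k]]] ltk] //= _ E0 E1.
- by apply: (coset_net_inj (i := @Ordinal 3 0 isT) (k := @Ordinal 3 1 isT)).
- exact: latin_inj02.
- by apply: (coset_net_inj (i := @Ordinal 3 0 isT) (k := @Ordinal 3 1 isT)).
- exact: latin_inj12.
- exact: latin_inj02.
- exact: latin_inj12.
Qed.

Lemma latin_net_realized i k v : exists w,
  coset_net i w = latin_net i v /\ coset_net k w = latin_net k v.
Proof.
have swap P Q : (exists w, P w /\ Q w) -> exists w : gT, Q w /\ P w.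
  by case=> w []; exists w.
have real02 : exists w, direction 0 :* w = direction 0 :* v /\
    direction 2 :* w = direction 2 :* lastpt v.
  have [[i' [j' [Ev lti ltj ->]]]|[_ ->]] := lastptP v; last by exists v.
  set t := latin_row p i' j'; have ltt : t <= p by rewrite ltnW ?latin_row_lt.
  (* In the coset net, symbol [j'] and row [t] meet in column [j' - t] modulo [p]. *)
  exists (x ^+ (j' + (p - t)) * y ^+ j'); split; apply/eqP; rewrite eq_rcosetE.
    by rewrite Ev invMg mulgA mulgK groupM ?groupV ?mem_cycle.
  suff -> : y ^+ j' = y ^+ (j' + (p - t)) * y ^+ t.
    by rewrite mulgA mulgK -expxy mem_cycle.
  by rewrite -expgD -addnA subnK // expgD -oy expg_order mulg1.
have real12 : exists w, direction 1 :* w = direction 1 :* v /\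
    direction 2 :* w = direction 2 :* lastpt v.
  have [[i' [j' [Ev lti ltj ->]]]|[_ ->]] := lastptP v; last by exists v.
  (* Column [i'] and row [t] meet at symbol [i' + t]. *)
  set t := latin_row p i' j'; exists ((x * y) ^+ i' * y ^+ t).
  split; apply/eqP; rewrite eq_rcosetE; last by rewrite mulgK mem_cycle.
  rewrite Ev expxy -(mulgA (x ^+ i') _ (y ^+ t)) -expgD.
  rewrite -(comm_exp i' (i' + t)) -(comm_exp i' j').
  by rewrite invMg mulgA mulgK groupM ?groupV ?mem_cycle.
rewrite /coset_net /latin_net.
case: i k => [[|[|[|i]]] lti] [[|[|[|k]]] ltk] //=; try by exists v.
- exact: swap.
- exact: swap.
- by exists (lastpt v).
Qed.

Definition net_set : {set gT} :=
  [set s | (s != 1) && [exists i : 'I_3, s \in direction i]].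

Lemma Cay_net_set : Cay net_set =2 collinear coset_net.
Proof.
move=> u v; rewrite /Cay /collinear /= inE -eq_mulgV1.
by congr (_ && _); apply: eq_existsb => i; rewrite eq_rcosetE.
Qed.

Lemma net_set1 : 1 \notin net_set. Proof. by rewrite inE eqxx. Qed.

Lemma net_setV : net_set^-1 = net_set.
Proof.
apply/setP=> s; rewrite !inE invg_eq1; congr (_ && _).
by apply: eq_existsb => i; rewrite groupV.
Qed.

Lemma cospectral_latin_net : cospectral (Cay net_set) (collinear latin_net).
Proof.
apply: eq_cospectral Cay_net_set _; apply: cospectral_nets.
- by rewrite card_ord.
- exact: coset_net_inj.
- exact: latin_net_inj.
- exact: latin_net_realized.
Qed.

(** * Cliques of four vertices in the two graphs *)

Let net_setP s :
  reflect (s != 1 /\ exists2 i, i < 3 & s \in direction i) (s \in net_set).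
Proof.
rewrite inE; apply: (iffP andP) => -[-> si]; split=> //.
  by have [i si'] := existsP si; exists i.
by have [i lti si'] := si; apply/existsP; exists (Ordinal lti).
Qed.

Let third i k m m' : i < 3 -> k < 3 -> m < 3 -> m' < 3 ->
  i != k -> m != i -> m != k -> m' != i -> m' != k -> m = m'.
Proof.
by case: i k m m' => [|[|[|i]]] [|[|[|k]]] [|[|[|m]]] [|[|[|m']]].
Qed.

(** If [a * b^-1] lay in the direction of [a] or of [b], the other element would lie in both
    directions and be trivial. *)
Let third_direction i k m a b : i < 3 -> k < 3 -> m < 3 ->
    i != k -> m != i -> m != k -> a \in direction i -> b \in direction k ->
  a != 1 -> b != 1 -> a * b^-1 \in net_set -> a * b^-1 \in direction m.
Proof.
move=> lti ltk ltm neq_ik mi mk ai bk a1 b1 /net_setP[_ [m' ltm' abm]].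
suff -> : m = m' by []; apply: (third lti ltk) => //.
  apply: contraNneq b1 => Em; rewrite Em groupMl // groupV in abm.
  by have /set1P-> : b \in [1] by rewrite -(direction_TI lti ltk neq_ik) inE abm.
apply: contraNneq a1 => Em; rewrite Em groupMr ?groupV // in abm.
by have /set1P-> : a \in [1] by rewrite -(direction_TI lti ltk neq_ik) inE ai.
Qed.

Let two_one i k a b c : i < 3 -> k < 3 -> i != k ->
    a \in direction i -> b \in direction i -> c \in direction k ->
    a != 1 -> b != 1 -> c != 1 -> a != b ->
    c * a^-1 \in net_set -> c * b^-1 \in net_set -> False.
Proof.
move=> lti ltk neq_ik ai bi ck a1 b1 c1 neq_ab ca cb.
have [m ltm [mi mk]] : exists2 m, m < 3 & m != i /\ m != k.
  exists (3 - (i + k)).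
    by case: i k lti ltk neq_ik {ai bi ck} => [|[|[|i]]] [|[|[|k]]].
  by case: i k lti ltk neq_ik {ai bi ck} => [|[|[|i]]] [|[|[|k]]].
rewrite eq_sym in neq_ik.
have cam := third_direction ltk lti ltm neq_ik mk mi ck ai c1 a1 ca.
have cbm := third_direction ltk lti ltm neq_ik mk mi ck bi c1 b1 cb.
have : a * b^-1 \in direction m :&: direction i.
  apply/setIP; split; last by rewrite groupM ?groupV.
  have -> : a * b^-1 = (c * a^-1)^-1 * (c * b^-1).
    by rewrite invMg invgK mulgA mulgKV.
  by rewrite groupM ?groupV.
rewrite direction_TI // => /set1P/eqP; rewrite -eq_mulgV1.
exact/negP.
Qed.

(* Parallelogram with sides x and y whose two diagonals are both parallel to
   x * y: impossible in odd characteristic. *)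
Let all_distinct a b c : a \in <[x]> -> b \in <[y]> -> c \in <[x * y]> ->
    a != 1 -> b != 1 -> c != 1 ->
    a * b^-1 \in net_set -> a * c^-1 \in net_set -> b * c^-1 \in net_set ->
  False.
Proof.
move=> ax by_ cz a1 b1 c1 ab ac bc.
have {}ab := @third_direction 0 1 2 a b isT isT isT isT isT isT ax by_ a1 b1 ab.
have {}ac := @third_direction 0 2 1 a c isT isT isT isT isT isT ax cz a1 c1 ac.
have {}bc := @third_direction 1 2 0 b c isT isT isT isT isT isT by_ cz b1 c1 bc.
have /cycleP[i Ea] := ax; have /cycleP[j Eb] := by_; have /cycleP[k Ec] := cz.
rewrite expxy in Ec.
have /cycleP[s /(canRL (mulgKV _))] := ab; rewrite expxy Ea Eb => Eab.
have /cycleP[t /(canRL (mulgKV _))] := ac; rewrite Ea Ec mulgA comm_exp => Eac.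
have /cycleP[u /(canRL (mulgKV _))] := bc; rewrite Eb Ec mulgA -expgD => Ebc.
have [Eis Esj] : x ^+ i = x ^+ s /\ y ^+ 0 = y ^+ (s + j).
  by apply: xy_inj; rewrite expg0 mulg1 Eab expgD mulgA.
have [Eik _] : x ^+ i = x ^+ k /\ y ^+ 0 = y ^+ (t + k).
  by apply: xy_inj; rewrite expg0 mulg1 Eac expgD mulgA.
have [_ Ejk] : x ^+ 0 = x ^+ (u + k) /\ y ^+ j = y ^+ k.
  by apply: xy_inj; rewrite expg0 mul1g.
(* The exponents [i], [j], [k], [s] agree modulo [p] and [s + j] vanishes, so [b ^+ 2 = 1]; having
   odd order, [b] is trivial. *)
have Esk : y ^+ s = y ^+ k.
  by apply/eqP; rewrite eq_expg_mod_order oy -ox -eq_expg_mod_order -Eis Eik.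
case/negP: b1; rewrite Eb -in_set1; apply: (@odd_order_sqrt_mem _ 1%G).
  by apply: dvdn_odd (orderXdvd _ _) _; rewrite oy.
by rewrite inE expgS expg1 {1}Ejk -Esk -expgD -Esj expg0.
Qed.

Let net_setVE s : (s^-1 \in net_set) = (s \in net_set).
Proof. by rewrite -{1}net_setV inE invgK. Qed.

Let net_setC s t : (s * t^-1 \in net_set) = (t * s^-1 \in net_set).
Proof. by rewrite -net_setVE invMg invgK. Qed.

(** With [1] these form a 4-clique; [two_one] excludes that they occupy two directions,
    [all_distinct] that they occupy three. *)
Let common_direction a b c :
    a \in net_set -> b \in net_set -> c \in net_set ->
    a * b^-1 \in net_set -> a * c^-1 \in net_set -> b * c^-1 \in net_set ->
  exists2 i, i < 3 &
    [/\ a \in direction i, b \in direction i & c \in direction i].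
Proof.
move=> /net_setP[a1 [i lti ai]] /net_setP[b1 [j ltj bj]] /net_setP[c1 [k ltk ck]].
move=> ab ac bc.
have neq s t : s * t^-1 \in net_set -> s != t.
  by case/net_setP; rewrite -eq_mulgV1.
have [nab nac nbc] := And3 (neq _ _ ab) (neq _ _ ac) (neq _ _ bc).
have [Eij|nij] := eqVneq i j.
  have [Eik|nik] := eqVneq i k.
    by exists i => //; split; rewrite // ?Eij // -Eij Eik.
  rewrite -Eij in bj; rewrite net_setC in ac; rewrite net_setC in bc.
  by case: (two_one lti ltk nik ai bj ck).
have [Eik|nik] := eqVneq i k.
  rewrite -Eik in ck; rewrite net_setC in ab.
  by case: (two_one lti ltj nij ai ck bj).
have [Ejk|njk] := eqVneq j k.
  rewrite -Ejk in ck; rewrite eq_sym in nij.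
  by case: (two_one ltj lti nij bj ck ai).
exfalso; move: (ab) (ac) (bc); rewrite net_setC [a * c^-1 \in _]net_setC.
rewrite [b * c^-1 \in _]net_setC => ba ca cb.
case: i j k lti ltj ltk nij nik njk ai bj ck =>
  [|[|[|i]]] [|[|[|j]]] [|[|[|k]]] // _ _ _ _ _ _ ai bj ck.
- exact: (all_distinct ai bj ck).
- exact: (all_distinct ai ck bj).
- exact: (all_distinct bj ai ck).
- exact: (all_distinct ck ai bj).
- exact: (all_distinct bj ck ai).
- exact: (all_distinct ck bj ai).
Qed.

Let card_direction i : #|direction i| = p.
Proof.
suff oxy : #[x * y] = p by case: i => [|[|i]]; rewrite -orderE.
apply/eqP; rewrite eqn_dvd order_dvdn expxy -{1}ox -oy !expg_order mulg1 eqxx.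
rewrite oy -ox order_dvdn -(expg0 x); apply/eqP.
have [] // := @xy_inj #[x * y] #[x * y] 0 0.
by rewrite -expxy expg_order !expg0 mulg1.
Qed.

(* Four mutually adjacent vertices lie on a line, and lines have p > 4 points. *)
Lemma Cay_net_K4_extends w0 w1 w2 w3 (adj := Cay net_set) :
    adj w1 w0 -> adj w2 w0 -> adj w3 w0 -> adj w1 w2 -> adj w1 w3 -> adj w2 w3 ->
  exists v, [/\ adj v w0, adj v w1, adj v w2 & adj v w3].
Proof.
rewrite /adj /Cay /=; 
set a := w1 * w0^-1; set b := w2 * w0^-1; set c := w3 * w0^-1.
have quo u v : u * v^-1 = (u * w0^-1) * (v * w0^-1)^-1.
  by rewrite invMg invgK mulgA mulgKV.
move=> aS bS cS; rewrite (quo w1) (quo w1 w3) (quo w2 w3) => ab ac bc.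
have [i lti [ai bi ci]] := common_direction aS bS cS ab ac bc.
have /subsetPn[t ti] : ~~ (direction i \subset [set 1; a; b; c]).
  apply: contraL p_gt4 => /subset_leq_card; rewrite card_direction -leqNgt.
  move/leq_trans; apply; rewrite -!setUA.
  by rewrite !cardsU1 cards1; do 3!case: (_ \notin _).
rewrite !inE !negb_or => /andP[/andP[/andP[t1 ta] tb] tc].
have mem s : s \in direction i -> t != s -> t * s^-1 \in net_set.
  move=> si ts; apply/net_setP; rewrite -eq_mulgV1; split=> //.
  by exists i; rewrite // groupM ?groupV.
exists (t * w0); rewrite mulgK; split.
- by rewrite -[t]mulg1 -invg1 mem ?group1.
- by rewrite (quo _ w1) mulgK mem.
- by rewrite (quo _ w2) mulgK mem.
- by rewrite (quo _ w3) mulgK mem.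
Qed.

Let adj' := collinear latin_net.

(** The cells in columns 0, 1 with symbols 1, 2. The three classes pair them up in the three
    possible ways. A common neighbour [w] takes at most one pair per class, and pairs of different
    classes overlap, so [w] needs all three classes; the point shared by its pairs of classes 0 and
    1 is then [w] itself. *)
Let latin_K4 (q1 := y) (q2 := y ^+ 2) (q3 := x * y) (q4 := x * y ^+ 2) :
  [/\ [/\ adj' q2 q1, adj' q3 q1, adj' q4 q1, adj' q2 q3 & adj' q2 q4],
       adj' q3 q4 &
       forall w, ~ [/\ adj' w q1, adj' w q2, adj' w q3 & adj' w q4]].
Proof.
have lt0 : 0 < p := p_gt0; have lt1 : 1 < p by apply: ltn_trans p_gt4.
have lt2 : 2 < p by apply: ltn_trans p_gt4.
pose i0 : 'I_3 := @Ordinal 3 0 isT; pose i1 : 'I_3 := @Ordinal 3 1 isT.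
pose i2 : 'I_3 := @Ordinal 3 2 isT; pose l := latin_net.
have row i j t : latin_row p i j = t -> i < p -> j < p ->
    l i2 (x ^+ i * y ^+ j) = direction 2 :* y ^+ t.
  by move=> <- lti ltj; rewrite /l /latin_net /= lastpt_exp.
have rowq1 : l i2 q1 = direction 2 :* y.
  rewrite -[q1]mul1g -(expg0 x) -(expg1 q1) (row 0 1 1)%N // /latin_row /twist /=.
  by case: p p_gt4 => [|[|[|[|[|p']]]]].
have rowq2 : l i2 q2 = direction 2 :* y ^+ 2.
  rewrite -[q2]mul1g -(expg0 x) (row 0 2 2)%N // /latin_row /twist /=.
  by case: p p_gt4 => [|[|[|[|[|p']]]]].
have rowq3 : l i2 q3 = direction 2 :* y ^+ 2.
  rewrite -[q3]/(x ^+ 1 * y ^+ 1) (row 1 1 2)%N // /latin_row /twist /=.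
  by case: p p_gt4 => [|[|[|[|[|p']]]]].
have rowq4 : l i2 q4 = direction 2 :* y.
  rewrite -[q4]/(x ^+ 1 * y ^+ 2) (row 1 2 1)%N // /latin_row /twist /=.
  by case: p p_gt4 => [|[|[|[|[|p']]]]].
have y1 : y != 1 by rewrite -order_gt1 oy.
have x1 : x != 1 by rewrite -order_gt1 ox.
have ny1 : y \notin <[x]>.
  apply: contra y1 => yx; rewrite -in_set1.
  by have := tiXY => /setP/(_ y); rewrite !inE yx cycle_id => <-.
have nx1 : x \notin <[y]>.
  apply: contra x1 => xy; rewrite -in_set1.
  by have := tiXY => /setP/(_ x); rewrite !inE xy cycle_id => <-.
have y2y : y ^+ 2 * y^-1 = y by rewrite expgS expg1 mulgK.
have sym0 : l i0 q3 = l i0 q1.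
  by apply/eqP; rewrite eq_rcosetE mulgK cycle_id.
have sym2 : l i0 q4 = l i0 q2.
  by apply/eqP; rewrite eq_rcosetE mulgK cycle_id.
have nsym : l i0 q1 <> l i0 q2.
  by move/esym/eqP; rewrite eq_rcosetE /= y2y (negPf ny1).
have col0 : l i1 q2 = l i1 q1.
  by apply/eqP; rewrite eq_rcosetE y2y cycle_id.
have col2 : l i1 q4 = l i1 q3.
  apply/eqP; rewrite eq_rcosetE /= /q3 /q4 invMg mulgA -(mulgA x) y2y.
  by rewrite cxy mulgK cycle_id.
have ncol : l i1 q1 <> l i1 q3.
  by move/esym/eqP; rewrite eq_rcosetE /= mulgK (negPf nx1).
have nrow : l i2 q1 <> l i2 q2.
  rewrite rowq1 rowq2 => /esym/eqP; rewrite eq_rcosetE y2y => yZ.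
  case/negP: y1; rewrite -in_set1.
  by have := tiYZ => /setP/(_ y); rewrite !inE yZ cycle_id => <-.
have colP u v i : u <> v -> l i u = l i v -> adj' u v.
  by move=> /eqP nuv E; rewrite /adj' /collinear /= nuv; apply/existsP; exists i;
    apply/eqP.
have n12 : q2 <> q1 by move=> E; case: nsym; rewrite E.
have n13 : q3 <> q1 by move=> E; case: ncol; rewrite E.
have n14 : q4 <> q1 by move=> E; case: nsym; rewrite -sym2 E.
have n23 : q2 <> q3 by move=> E; case: nsym; rewrite E sym0.
have n24 : q2 <> q4 by move=> E; case: ncol; rewrite -col0 E col2.
have n34 : q3 <> q4 by move=> E; case: nsym; rewrite -sym0 E.
split; first split.
- exact: colP n12 col0.
- exact: colP n13 sym0.
- by apply: (colP _ _ i2 n14); rewrite rowq4.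
- by apply: (colP _ _ i2 n23); rewrite rowq2.
- exact: colP n24 (esym sym2).
- exact: colP n34 (esym col2).
move=> w; have ex q : adj' w q -> w <> q /\
    [\/ l i0 w = l i0 q, l i1 w = l i1 q | l i2 w = l i2 q].
  rewrite /adj' /collinear /= => /andP[/eqP nwq /existsP[i /eqP E]]; split=> //.
  case: i E => [[|[|[|i]]] lti] // E; [constructor 1|constructor 2|constructor 3];
    by rewrite /l /latin_net /= in E *.
have inj q : l i0 w = l i0 q -> l i1 w = l i1 q -> w = q.
  exact: latin_net_inj.
rewrite -rowq1 in rowq4; rewrite -rowq2 in rowq3.
move: (inj q1) (inj q2) (inj q3) (inj q4) => I1 I2 I3 I4.
case=> /ex[nw1 E1] /ex[nw2 E2] /ex[nw3 E3] /ex[nw4 E4].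
by case: E1 => E1; case: E2 => E2; case: E3 => E3; case: E4 => E4;
  first [congruence | apply: nw1; apply: I1; congruence
    | apply: nw2; apply: I2; congruence | apply: nw3; apply: I3; congruence
    | apply: nw4; apply: I4; congruence].
Qed.

Lemma DS_latin_false : DS_group gT -> False.
Proof.
move=> DS; have [h [h' hK h'K] hE] :=
  DS _ net_set1 net_setV _ _ (simple_collinear _) cospectral_latin_net.
have adjE u v : Cay net_set (h' u) (h' v) = adj' u v by rewrite -hE !h'K.
have [[a21 a31 a41 a23 a24] a34 noext] := latin_K4.
rewrite -!adjE in a21 a31 a41 a23 a24 a34.
have [v [v1 v2 v3 v4]] := Cay_net_K4_extends a21 a31 a41 a23 a24 a34.
by case: (noext (h v)); rewrite -!adjE !hK.
Qed.

End LatinNet.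

(** * Groups with cyclic Sylow subgroups *)

Section ZgroupStructure.

Variable gT : finGroupType.
Implicit Types G S : {group gT}.

(** Being abelian, [S] and [S :^ t] are both Sylow in the centralizer of [u ^ t]. An element [c] of
    it conjugates one to the other, so [t * c] normalizes [S] and hence fixes [u]. *)
Lemma Sylow_norm_cent_fusion p G S u t :
    p.-Sylow(G) S -> abelian S -> 'N_G(S) \subset 'C(S) ->
    u \in S -> t \in G -> u ^ t \in S -> u ^ t = u.
Proof.
move=> sylS abS cNS Su Gt Sut; have [sSG pS _] := and3P sylS.
have subC (P : {group gT}) : p.-Sylow(G) P -> abelian P -> u ^ t \in P ->
    p.-Sylow('C_G[u ^ t]) P.
  move=> sylP abP Put; apply: (pHall_subl _ _ sylP); last exact: subsetIl.
  rewrite subsetI (pHall_sub sylP) sub_cent1 /=.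
  exact: subsetP abP _ Put.
have sylSt : p.-Sylow(G) (S :^ t) by rewrite pHallJ.
have sylSt' : p.-Sylow('C_G[u ^ t]) (S :^ t).
  by apply: (subC (S :^ t)%G); rewrite ?abelianJ ?memJ_conjg.
have [c /setIP[Gc cutc] defS] := Sylow_trans sylSt' (subC S sylS abS Sut).
have Ntc : t * c \in 'N_G(S).
  by rewrite inE groupM //= inE conjsgM -defS.
have /cent1P cutc' := cutc.
transitivity (u ^ (t * c)); first by rewrite conjgM [_ ^ c]conjgE -cutc' mulKg.
by rewrite conjgE -(centP (subsetP cNS _ Ntc) u Su) mulKg.
Qed.

(* The transfer into [S] acts on [S] as the power map of exponent [#|G : S|]. *)
Lemma Burnside_transfer p G S :
    p.-Sylow(G) S -> abelian S -> 'N_G(S) \subset 'C(S) ->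
  exists K : {group gT}, [/\ K <| G, abelian (G / K) & K :&: S = 1].
Proof.
move=> sylS abS cNS; have [sSG pS p'GS] := and3P sylS.
have abA : abelian (idm_morphism S @* S) by rewrite morphim_idm.
pose tau := transfer_morphism G abA; exists ('ker tau)%G; split.
- exact: ker_normal.
- rewrite (isog_abelian (first_isog tau)); exact: FinRing.zmod_abelian.
apply/trivgP/subsetP=> g /setIP[Kg Sg]; have Gg := subsetP sSG g Sg.
have trX := transversalP (rcosets_cycle_partition sSG Gg).
have := mker Kg; rewrite /= (transfer_cycle_expansion sSG abA Gg trX).
set n_ := fun x => #|<[g]> : S :* x|.
have termE x : x \in transversal (rcosets S G :* <[g]>) G ->
    (g ^+ n_ x) ^ x^-1 = g ^+ n_ x.
  move=> Xx; have Gx := subsetP (transversal_sub trX) _ Xx.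
  apply: (Sylow_norm_cent_fusion sylS); rewrite ?groupX ?groupV //.
  by rewrite conjgE invgK mulgA -mem_rcoset mulg_exp_card_rcosets.
have Ag : g \in idm_morphism S @* S by rewrite morphim_idm.
have nE : (\sum_(x in transversal (rcosets S G :* <[g]>) G) n_ x)%N = #|G : S|.
  exact: sum_index_rcosets_cycle.
rewrite (eq_bigr (fun x => FiniteModule.fmod abA g *+ n_ x)%R); last first.
  by move=> x Xx; rewrite -/(n_ x) termE //= /restrm /= FiniteModule.fmodX.
rewrite GRing.sumrMnr nE -FiniteModule.fmodX // => /FiniteModule.congr_fmod.
rewrite [LHS]FiniteModule.fmodK ?groupX //= => gGS.
have : #[g] %| #|G : S| by rewrite order_dvdn gGS.
have pg : p.-nat #[g] := mem_p_elt pS Sg.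
rewrite inE -order_eq1 -dvdn1 => dvd_g.
by rewrite -(eqP (pnat_coprime pg p'GS)) dvdn_gcd dvdnn.
Qed.

Lemma Zgroup_Sylow_cyclic p G S :
  prime p -> Zgroup G -> p.-Sylow(G) S -> cyclic S.
Proof.
by move=> pr_p ZG sylS; apply: (forall_inP ZG); apply/SylowP; exists p.
Qed.

(** The normalizer acts on [S] as a group of order prime to [p], whose prime divisors exceed the
    least prime [p]; none divides [#|Aut S|], which is [p - 1] times a power of [p]. *)
Lemma cyclic_Sylow_pdiv_norm_cent G S (p := pdiv #|G|) :
  p.-Sylow(G) S -> cyclic S -> 'N_G(S) \subset 'C(S).
Proof.
move=> sylS cycS; have [sSG pS p'GS] := and3P sylS.
have [S1|ntS] := eqsVneq S 1; first by rewrite S1 cents1.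
pose A := conj_aut S @* 'N_G(S).
have [pr_p p_dvd_S [k oS]] := pgroup_pdiv pS ntS.
have dvdA : #|A| %| #|'N_G(S) : S|.
  rewrite card_morphim ker_conj_aut (setIidPr (subsetIr _ _)).
  have sSN : S \subset 'N_G(S) by rewrite subsetI sSG normG.
  have <- : #|'N_G(S) : 'C_('N_G(S))(S)| = #|'N_G(S) : 'C(S)|.
    by rewrite indexgI.
  rewrite -(Lagrange_index (subsetIl _ _) (_ : S \subset 'C_('N_G(S))(S))).
    exact: dvdn_mulr.
  by rewrite subsetI sSN; apply: cyclic_abelian.
have p'A : p^'.-nat #|A|.
  apply: pnat_dvd dvdA _; apply: pnat_dvd p'GS.
  by apply: indexSg; rewrite ?subsetIl // subsetI sSG normG.
suff A1 : #|A| = 1%N.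
  have /trivgP := card1_trivg A1.
  by rewrite sub_morphim_pre ?subsetIr // -ker_conj_aut.
apply/eqP; apply: contraT => ntA.
have {}ntA : 1 < #|A| by rewrite ltn_neqAle eq_sym ntA cardG_gt0.
set q := pdiv #|A|; have pr_q : prime q := pdiv_prime ntA.
have q_dvd_A : q %| #|A| := pdiv_dvd _.
have neq_qp : q != p by apply: (pnatPpi p'A); rewrite mem_primes pr_q cardG_gt0.
have le_pq : p <= q.
  apply: pdiv_min_dvd; first exact: prime_gt1.
  apply: dvdn_trans q_dvd_A (dvdn_trans dvdA _).
  exact: dvdn_trans (dvdn_indexg _ _) (cardSg (subsetIl _ _)).
have : q %| #|Aut S| := dvdn_trans q_dvd_A (cardSg (Aut_conj_aut _ _)).
rewrite card_Aut_cyclic // oS totient_pfactor // Euclid_dvdM //.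
rewrite Euclid_dvdX // (dvdn_prime2 pr_q pr_p) (negPf neq_qp) orbF.
have p1_gt0 : 0 < p.-1 by rewrite -subn1 subn_gt0 prime_gt1.
by move/(dvdn_leq p1_gt0); rewrite -ltnS prednK ?prime_gt0 // ltnNge le_pq.
Qed.

(** For the least prime, [S] is nontrivial and meets [K] trivially, so [K] is proper and induction
    applies to it. *)
Lemma Zgroup_solvable G : Zgroup G -> solvable G.
Proof.
have [n] := ubnP #|G|; elim: n G => // n IHn G leGn ZG.
have [G1|ntG] := eqsVneq G 1; first by rewrite G1 solvable1.
have pr_p : prime (pdiv #|G|) by rewrite pdiv_prime // cardG_gt1.
have [S sylS] := Sylow_exists (pdiv #|G|) G.
have cycS := Zgroup_Sylow_cyclic pr_p ZG sylS.
have [K [nsKG abGK tiKS]] := Burnside_transfer sylS (cyclic_abelian cycS)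
  (cyclic_Sylow_pdiv_norm_cent sylS cycS).
rewrite (series_sol nsKG) (abelian_sol abGK) andbT.
have sKG := normal_sub nsKG; apply: IHn (ZgroupS sKG ZG).
rewrite ltnS in leGn; apply: leq_trans leGn; apply: proper_card.
rewrite properEneq sKG andbT; apply: contraTneq (pdiv_dvd #|G|) => KG.
have S1 : S :=: 1 by rewrite -tiKS KG (setIidPr (pHall_sub sylS)).
by rewrite -p'natE // -partn_eq1 ?cardG_gt0 // -(card_Hall sylS) S1 cards1.
Qed.

Lemma Zgroup_quotient G (H : {group gT}) : Zgroup G -> Zgroup (G / H).
Proof. exact: morphim_Zgroup. Qed.

Lemma Zgroup_abelian_cyclic (rT : finGroupType) (H : {group rT}) :
  Zgroup H -> abelian H -> cyclic H.
Proof. by move=> ZH abH; rewrite nil_Zgroup_cyclic ?abelian_nil. Qed.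

(** The factor of the second by the third derived subgroup is cyclic with abelian automorphism
    group, so the first centralizes it. The first modulo the third is then central-by-cyclic, hence
    abelian, and solvability makes the second trivial. *)
Lemma Zgroup_der1_cyclic G : Zgroup G -> cyclic G^`(1).
Proof.
move=> ZG; have solG := Zgroup_solvable ZG.
have Zder n : Zgroup G^`(n) by apply: ZgroupS ZG; apply: der_sub.
have cycq n : cyclic (G^`(n) / G^`(n.+1)).
  apply: Zgroup_abelian_cyclic (Zgroup_quotient _ (Zder n)) _.
  exact: der_abelian.
suff D2 : G^`(2) = 1.
  by apply: Zgroup_abelian_cyclic (Zder 1%N) _; apply/derG1P.
apply/eqP; apply: contraT => ntD2.
have := sol_der1_proper solG (der_sub 2 G) ntD2.
rewrite properE => /andP[_ /negP[]].
pose H := (G^`(3))%G; rewrite -[_^`(1)]/(gval H).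
have nHG : G \subset 'N(H) by apply: der_norm.
have nHD n : G^`(n) \subset 'N(H) := subset_trans (der_sub n G) nHG.
apply: (@der1_min _ G^`(1)%G); first exact: nHD.
have sHD2 : H \subset G^`(2) := der_subS 2 G.
have sHD1 : H \subset G^`(1) := subset_trans sHD2 (der_subS 1 G).
pose B := (G^`(2) / H)%G.
have cBD : G^`(1) / H \subset 'C(B).
  have nBG : G / H \subset 'N(B) by rewrite quotient_norms ?der_norm.
  rewrite quotient_der // -ker_conj_aut -sub_morphim_pre; last first.
    exact: subset_trans (der_sub _ _) nBG.
  rewrite morphim_der //; apply/trivgP/derG1P.
  exact: abelianS (Aut_conj_aut _ _) (Aut_cyclic_abelian (cycq 2)).
apply: (@cyclic_factor_abelian _ B (G^`(1) / H)%G).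
  by rewrite subsetI quotientS ?der_subS // centsC.
rewrite (isog_cyclic (third_isog sHD2 _ _)) ?cycq //.
  by rewrite /normal sHD1 nHD.
exact: der_normalS.
Qed.

Theorem Zgroup_metacyclic_gens G : Zgroup G ->
  exists a b : gT, exists r : nat,
    [/\ <[a]> ><| <[b]> = G, a ^ b = a ^+ r, r <= #[a]
      & coprime #[a] (#[b] * (r + #[a]).-1)].
Proof.
move=> ZG; have /cyclicP[a defD] := Zgroup_der1_cyclic ZG.
have /cyclicP[bb defGD] : cyclic (G / G^`(1)).
  by apply: Zgroup_abelian_cyclic (Zgroup_quotient _ ZG) _; apply: der_abelian.
have nsD : <[a]> <| G by rewrite -defD der_normal.
have [sDG nDG] := andP nsD.
have /morphimP[b Nb Gb defbb] : bb \in G / G^`(1) by rewrite defGD cycle_id.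
have Ga : a \in G by rewrite -cycle_subG.
have defG : <[a]> * <[b]> = G.
  apply/eqP; rewrite eqEsubset mul_subG ?cycle_subG //=.
  rewrite -{1}defD -quotientSK ?der_norm // defGD quotient_cycle //.
  by rewrite defbb.
have Dab : a ^ b \in <[a]> by rewrite memJ_norm ?cycle_id ?(subsetP nDG).
have /cyclePmin[r ltr abr] := Dab.
(* The exponent is [r - 1] shifted by [#[a]], since [r = 0] occurs when [a] is trivial. *)
pose c := [~ a, b]; have cE : c = a ^+ (r + #[a]).-1.
  apply: (mulgI a); rewrite /c commgEl mulKVg abr -expgS.
  rewrite prednK ?addn_gt0 ?order_gt0 ?orbT //.
  by rewrite expgD expg_order mulg1.
have Dc : <[c]> \subset <[a]> by rewrite cE cycle_subG mem_cycle.
have nsC : <[c]> <| G.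
  by apply: char_normal_trans nsD; rewrite sub_cyclic_char ?cycle_cyclic.
have nCG := normal_norm nsC.
(* Modulo [<[c]>] the generators [a] and [b] commute, so [<[c]>] contains the derived subgroup
   [<[a]>]. *)
have defDc : <[a]> = <[c]>.
  apply/eqP; rewrite eqEsubset Dc andbT -{1}defD; apply: der1_min => //.
  have [Na Nb'] := (subsetP nCG a Ga, subsetP nCG b Gb).
  have cab : commute (coset <[c]> a) (coset <[c]> b).
    apply/commgP; rewrite -morphR //=; apply/eqP/coset_id; exact: cycle_id.
  rewrite /= -{1}defG quotientMl ?cycle_subG // !quotient_cycle //.
  rewrite abelianM !cycle_abelian /=; apply/centsP=> _ /cycleP[i ->] _ /cycleP[j ->].
  exact/commute_sym/commuteX2.
have oc : #[c] = #[a] by rewrite !orderE defDc.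
(* If [a ^+ k] is in [<[b]>], it commutes with [b]; then [c ^+ k = 1], and [c] has the order of
   [a]. *)
have tiab : <[a]> :&: <[b]> = 1.
  apply/trivgP/subsetP=> u /setIP[/cycleP[k ->] /cycleP[j Eu]].
  have : c ^+ k == 1.
    rewrite /c commgEl expgMn; last first.
      by rewrite abr; apply/commute_sym/commuteV/commute_sym/commuteX.
    by rewrite expgVn -conjXg Eu conjgE -expgSr expgS mulKg mulVg.
  by rewrite -order_dvdn oc order_dvdn inE.
exists a, b, r; split=> //.
- by rewrite sdprodE // cycle_subG; apply: (subsetP nDG).
- exact: ltnW.
rewrite coprimeMr -(generator_coprime a (r + #[a]).-1) -cE /generator defDc.
rewrite eqxx andbT; apply: contraT => ncop.
(* Subgroups of order [q] in [<[a]>] and [<[b]>] lie in one Sylow subgroup, the first being normal;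
   as it is cyclic they coincide, against [tiab]. *)
set q := pdiv (gcdn #[a] #[b]); have pr_q : prime q.
  by rewrite pdiv_prime // ltn_neqAle eq_sym ncop gcdn_gt0 order_gt0.
have := pdiv_dvd (gcdn #[a] #[b]); rewrite -/q dvdn_gcd => /andP[].
move=> /(Cauchy pr_q)[u au ou] /(Cauchy pr_q)[v bv ov].
have nsu : <[u]> <| G.
  apply: char_normal_trans nsD.
  by rewrite sub_cyclic_char ?cycle_cyclic // cycle_subG.
have Gv : v \in G by rewrite -defG -[v]mul1g mem_mulg.
have sQG : <[u]> <*> <[v]> \subset G by rewrite join_subG (normal_sub nsu) cycle_subG.
have qQ : q.-group (<[u]> <*> <[v]>).
  rewrite norm_joinEr; last by rewrite cycle_subG (subsetP (normal_norm nsu)).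
  by rewrite pgroupM /pgroup -!orderE ou ov pnat_id.
have [S sylS] := Sylow_superset sQG qQ; rewrite join_subG => /andP[suS svS].
have := eq_subG_cyclic (Zgroup_Sylow_cyclic pr_q ZG sylS) suS svS.
rewrite -!orderE ou ov eqxx => /eqP uv.
have : u \in <[a]> :&: <[b]>.
  by rewrite inE au (subsetP (_ : <[v]> \subset <[b]>)) ?cycle_subG // -uv cycle_id.
rewrite tiab => /set1P u1; rewrite u1 order1 in ou.
by rewrite -ou in pr_q.
Qed.

End ZgroupStructure.

(** Given [x'] and [y'] with these relations, the maps of the two cyclic factors respect
    conjugation, so they glue to a morphism from the semidirect product. *)
Lemma metacyclic_isoGrp (gT : finGroupType) (G : {group gT}) (x y : gT)
    (r : nat) (m := #[x]) (n := #[y]) :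
    <[x]> ><| <[y]> = G -> x ^ y = x ^+ r ->
  G \isog Grp (a : b : a ^+ m = 1, b ^+ n = 1, b^-1 * a * b = a ^+ r).
Proof.
move=> defG xyr; have [_ mulG nxy tixy] := sdprodP defG.
apply: intro_isoGrp => [|rT H].
  apply/existsP; exists (x, y); rewrite /= !xpair_eqE -mulgA -conjgE xyr.
  by rewrite !expg_order !eqxx norm_joinEr // mulG eqxx.
case/existsP=> -[x' y'] /= /eqP[defH x'm y'n x'y'].
have {}x'y' : x' ^ y' = x' ^+ r by rewrite conjgE mulgA.
have fxP : #[x'] %| #[x] by rewrite order_dvdn x'm.
have fyP : #[y'] %| #[y] by rewrite order_dvdn y'n.
have fP : {in <[x]> & <[y]>, morph_act 'J 'J (eltm fxP) (eltm fyP)}.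
  move=> _ _ /cycleP[i ->] /cycleP[j ->] /=; rewrite !eltmE.
  have conjXr (hT : finGroupType) (s t : hT) :
      s ^ t = s ^+ r -> (s ^+ i) ^ (t ^+ j) = s ^+ (i * r ^ j).
    move=> st; elim: j => [|j IHj]; first by rewrite conjg1 muln1.
    by rewrite expgSr conjgM IHj conjXg st -expgM expnS mulnCA.
  by rewrite !conjXr // eltmE.
apply/homgP; exists (sdprodm_morphism defG fP).
rewrite im_sdprodm !morphim_cycle ?cycle_id //= !eltm_id -norm_joinEr //.
by rewrite norms_cycle x'y' mem_cycle.
Qed.

(** * From DS groups to the presentation *)

Lemma DS_p2Elem_false (gT : finGroupType) (p : nat) (A E : {group gT}) :
  DS_group gT -> odd p -> 4 < p -> E \in 'E_p^2(A) -> False.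
Proof.
move=> DS odd_p p_gt4 pE; have [_ abE cardE] := pnElemPcard pE.
have pr_p := pnElem_prime pE; have pr_gt1 := prime_gt1 pr_p.
have [cEE expE] := abelemP pr_p abE.
have order_p z : z \in E -> z != 1 -> #[z] = p.
  by move=> Ez nz1; apply: nt_prime_order; rewrite ?expE.
have [x Ex x1] : exists2 x, x \in E & x != 1.
  by apply/trivgPn; rewrite -cardG_gt1 cardE (ltn_exp2l 0).
have ox := order_p x Ex x1.
have /subsetPn[y Ey xy] : ~~ (E \subset <[x]>).
  apply/negP=> /subset_leq_card; rewrite cardE -orderE ox.
  by rewrite leqNgt -{1}(expn1 p) ltn_exp2l.
have y1 : y != 1 by apply: contraNneq xy => ->; apply: group1.
apply: (@DS_latin_false gT p x y) => //; first exact: order_p.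
  exact: (centsP cEE).
by rewrite setIC prime_TIg -?orderE ?order_p // cycle_subG.
Qed.

Lemma DS_odd_Zgroup (gT : finGroupType) :
    DS_group gT -> odd #|[set: gT]| ->
    (forall P : {group gT}, 3.-Sylow([set: gT]) P ->
       ~ (P \isog [set: 'Z_3 * 'Z_3])) ->
  Zgroup [set: gT].
Proof.
move=> DS oddG not33; apply/forall_inP=> P /SylowP[p pr_p sylP].
have [sPG pP _] := and3P sylP; apply: contraT => ncP.
have odd_P : odd #|P| := dvdn_odd (cardSg sPG) oddG.
have odd_p : odd p.
  have ntP : P :!=: 1 by apply: contraNneq ncP => ->; apply: cyclic1.
  by have [_ p_dvd_P _] := pgroup_pdiv pP ntP; apply: dvdn_odd p_dvd_P odd_P.
have [p3|p_neq3] := eqVneq p 3.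
  rewrite p3 in pP sylP odd_p pr_p; case: (not33 P sylP).
  exact: noncyclic_order9_isog (DS_pgroup_card_leq DS pr_p odd_p pP ncP).
have p_gt4 : 4 < p.
  by case: p pr_p odd_p p_neq3 {sylP pP} => [|[|[|[|[|p]]]]].
have := ncP; rewrite (odd_pgroup_rank1_cyclic pP odd_P) -ltnNge.
by case/p_rank_geP=> E /(DS_p2Elem_false DS odd_p p_gt4).
Qed.

Theorem theorem6p2 (gT : finGroupType)
    (hDS : DS_group gT)
    (hodd : odd #|[set: gT]|)
    (hSyl : forall P : {group gT}, (3.-Sylow([set: gT]) P)%g ->
       ~ (P \isog [set: 'Z_3 * 'Z_3])%g) :
  exists m n r : nat,
    [/\ (0 < n)%N,
        odd m,
        (0 <= r <= m)%N,
        (r ^ n = 1 %[mod m])%N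
      & coprimez (m%:Z)%R (n%:Z * (r%:Z - 1))%R] /\
    ([set: gT] \isog Grp (a : b : a ^+ m = 1, b ^+ n = 1, b^-1 * a * b = a ^+ r))%g.
Proof.
have [a [b [r [defG abr le_r cop]]]] :=
  Zgroup_metacyclic_gens (DS_odd_Zgroup hDS hodd hSyl).
exists #[a], #[b], r; split; last exact: metacyclic_isoGrp defG abr.
have conjb k : a ^ (b ^+ k) = a ^+ (r ^ k).
  elim: k => [|k IHk]; first by rewrite conjg1.
  by rewrite expgSr conjgM IHk conjXg abr -expgM expnS.
split; rewrite ?order_gt0 //.
- by apply: dvdn_odd hodd; apply: order_dvdG; rewrite inE.
- by apply/eqP; rewrite -eq_expg_mod_order -conjb expg_order conjg1 expg1.
move: cop; rewrite coprimeMr => /andP[cop_n cop_r].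
rewrite coprimezMr; apply/andP; split; first by [].
have a_gt0 := order_gt0 a.
(* Adding [#[a]] keeps the gcd with [#[a]] and turns the integer [r - 1] into the natural number of
   [cop_r]. *)
have Er : (#[a]%:Z + (r%:Z - 1) = (r + #[a]).-1%:Z)%R by lia.
by rewrite /coprimez -gcdzDl Er -/(coprimez _ _) coprimezE.
Qed.
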